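(* Let $\gamma$ be a smooth curve in $\mathbb{R}^3$ which is the graph over a simple closed curve $\gamma_0$ in $\mathbb{R}^2$ with positive curvature. If the torsion $\tau$ of $\gamma$ satisfies $\tau \ge 0$ everywhere (or $\tau \le 0$ everywhere), then $\tau \equiv 0$, and hence $\gamma$ lies in a plane.
   Context: A simple closed curve $\gamma_0$ in $\mathbb{R}^2$ (smooth, regular, without self-intersections) has positive curvature if, upon choosing its orientation suitably, its signed curvature $\kappa_0$ is strictly positive everywhere. That $\gamma$ is a graph over $\gamma_0$ means $\gamma = (\gamma_0; h)$, i.e. the $xy$-components of $\gamma$ are those of $\gamma_0$ and the $z$-component is a smooth height function $h$ defined on the closed curve $\gamma_0$ (so $\gamma$ is closed). Torsion convention: for a curve parametrized by arc length with nonzero curvature $\kappa = |\gamma''|$, the Frenet frame satisfies $T'=\kappa N$, $N'=-\kappa T+\tau B$, $B'=-\tau N$; in an arbitrary regular parametrization, $\tau = \dfrac{(\gamma'\times\gamma'')\cdot\gamma'''}{|\gamma'\times\gamma''|^2}$. *)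

(* Defs.v *)
From Stdlib Require Import Reals.
From Coquelicot Require Import Coquelicot.

Open Scope R_scope.

(* [R * R * R] parses as [(R * R) * R], so a point of space is a pair made of
   its xy-projection and its height. *)
Definition px (p : R * R * R) : R := fst (fst p).
Definition py (p : R * R * R) : R := snd (fst p).
Definition pz (p : R * R * R) : R := snd p.

Definition dot3 (u v : R * R * R) : R :=
  px u * px v + py u * py v + pz u * pz v.

Definition cross (u v : R * R * R) : R * R * R :=
  (py u * pz v - pz u * py v,
   pz u * px v - px u * pz v,
   px u * py v - py u * px v).

Definition det2 (u v : R * R) : R := fst u * snd v - snd u * fst v.

Definition norm2 (u : R * R) : R := sqrt (fst u ^ 2 + snd u ^ 2).

Definition norm3 (u : R * R * R) : R := sqrt (dot3 u u).

Definition smooth (f : R -> R) : Prop :=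
  forall (n : nat) (t : R), ex_derive_n f n t.

Definition smooth_curve2 (c : R -> R * R) : Prop :=
  smooth (fun t => fst (c t)) /\ smooth (fun t => snd (c t)).

Definition smooth_curve3 (c : R -> R * R * R) : Prop :=
  smooth (fun t => px (c t)) /\
  smooth (fun t => py (c t)) /\
  smooth (fun t => pz (c t)).

Definition D2 (n : nat) (c : R -> R * R) (t : R) : R * R :=
  (Derive_n (fun s => fst (c s)) n t, Derive_n (fun s => snd (c s)) n t).

Definition D3 (n : nat) (c : R -> R * R * R) (t : R) : R * R * R :=
  (Derive_n (fun s => px (c s)) n t,
   Derive_n (fun s => py (c s)) n t,
   Derive_n (fun s => pz (c s)) n t).

Definition regular2 (c : R -> R * R) : Prop := forall t : R, D2 1 c t <> (0, 0).

(* A closed curve is a periodic map of the line, with an arbitrary (not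
   necessarily arc-length) parameter; it is simple when it is injective on one
   period. *)
Definition simple_closed (c : R -> R * R) : Prop :=
  exists L : R, 0 < L /\
    (forall t : R, c (t + L) = c t) /\
    (forall s t : R, 0 <= s < L -> 0 <= t < L -> c s = c t -> s = t).

Definition signed_curvature (c : R -> R * R) (t : R) : R :=
  det2 (D2 1 c t) (D2 2 c t) / norm2 (D2 1 c t) ^ 3.

Definition reverse (c : R -> R * R) (t : R) : R * R := c (- t).

Definition positive_curvature (c : R -> R * R) : Prop :=
  (forall t : R, 0 < signed_curvature c t) \/
  (forall t : R, 0 < signed_curvature (reverse c) t).

(* The height [h] is a function of the point of the plane curve; its values off
   the trace of [c0] are irrelevant, and its smoothness on the curve is read in
   the parameter of [c0]. *)
Definition graph_over (c : R -> R * R * R) (c0 : R -> R * R) : Prop :=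
  exists h : R * R -> R,
    smooth (fun t => h (c0 t)) /\ (forall t : R, c t = (c0 t, h (c0 t))).

Definition torsion (c : R -> R * R * R) (t : R) : R :=
  dot3 (cross (D3 1 c t) (D3 2 c t)) (D3 3 c t)
  / norm3 (cross (D3 1 c t) (D3 2 c t)) ^ 2.

Definition lies_in_plane (c : R -> R * R * R) : Prop :=
  exists (n : R * R * R) (d : R),
    n <> (0, 0, 0) /\ (forall t : R, dot3 n (c t) = d).

(* Main.v *)
Require Import Defs.
From Stdlib Require Import Reals ZArith Lra Lia Classical FunctionalExtensionality.
From Coquelicot Require Import Coquelicot.
Open Scope R_scope.

(** Write the curve as (x, y, h) and orient the plane so that
    k = x'y'' - y'x'' is positive (exchange x and y otherwise).  Since k never
    vanishes, the osculating plane at time t is a graph over the xy-plane, with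
    slopes a, b determined by h' = a x' + b y' and h'' = a x'' + b y''.
    Differentiating these equations gives a' = - lambda y', b' = lambda x', where
    lambda = W / k^2 and W = det (gamma', gamma'', gamma''') has the sign of the
    torsion.  Hence c = h - a (x - x(0)) - b (y - y(0)), the height of the
    osculating plane above the point gamma0(0), satisfies c' = lambda S with
    S = (x - x(0)) y' - (y - y(0)) x'.

    If gamma0 lies on the left of each of its tangent lines then S >= 0, so for a
    torsion of constant sign the periodic function c is monotone, hence constant,
    and lambda S = 0.  But S vanishes on no interval: there S = S' = 0 would force
    gamma0 = gamma0(0).  So W = 0 everywhere by continuity, a, b and c are
    constant, and they give the plane (planar_of_nonneg_torsion_det).

    It remains to prove that a simple closed curve with k > 0 lies on the left of
    its tangents (loop_left_of_tangents).  After a rotation this says that a point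
    where the curve runs horizontally to the right, a bottom, is a lowest point
    (bottom_is_lowest).  Otherwise let N be a highest bottom; it lies strictly
    above some point of the curve.  Let M be the top before N, M2 the top after N
    and N2 the bottom after M2, and suppose that M2 is not above M, the other case
    being its mirror image.  Between consecutive ones of these points the curve is
    a graph over the y-axis.  It turns left at N, so the branch rising from N to M2
    stays to the right of the branch falling from M to N: to change sides it would
    have to cross it (fold_opens).  Likewise the branch falling from M2 to N2 stays
    to the left of the branch rising from N to M2.  So this last branch is to the
    right of the branch from M to N at the height of M2, and to its left at the
    height of N, a height that it reaches because N2 is not above N.  The two
    branches cross, although the curve is simple (spiral_in). *)

(** * Real functions of one variable *)

Lemma continuity_of_derive (f f' : R -> R) :
  (forall t, is_derive f t (f' t)) -> continuity f.
Proof.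
  intros Hf t; apply derivable_continuous_pt.
  exists (f' t); now apply is_derive_Reals.
Qed.

Lemma mean_value (f f' : R -> R) (a b : R) :
  (forall t, is_derive f t (f' t)) -> a < b ->
  exists c, a < c < b /\ f b - f a = f' c * (b - a).
Proof.
  intros Hf Hab.
  destruct (MVT_cor2 f f' a b Hab) as [c [Hc Hin]].
  - intros c _; now apply is_derive_Reals.
  - now exists c.
Qed.

Lemma strictly_increasing_of_derive (f f' : R -> R) (a b : R) :
  (forall t, is_derive f t (f' t)) -> (forall t, a < t < b -> 0 < f' t) ->
  forall s t, a <= s -> s < t -> t <= b -> f s < f t.
Proof.
  intros Hf Hpos s t Hs Hst Ht.
  destruct (mean_value f f' s t Hf Hst) as [c [Hc E]].
  assert (0 < f' c) by (apply Hpos; lra).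
  assert (0 < f' c * (t - s)) by (apply Rmult_lt_0_compat; lra).
  lra.
Qed.

Lemma locally_increasing (f : R -> R) (a l : R) :
  is_derive f a l -> 0 < l ->
  exists d, 0 < d /\ (forall t, a < t < a + d -> f a < f t)
            /\ (forall t, a - d < t < a -> f t < f a).
Proof.
  intros Hf Hl; apply is_derive_Reals in Hf.
  destruct (Hf l Hl) as [d Hd].
  assert (Hsign : forall u, u <> 0 -> Rabs u < d -> 0 < (f (a + u) - f a) / u).
  { intros u Hu Hud; specialize (Hd u Hu Hud); apply Rabs_def2 in Hd; lra. }
  exists d; split; [apply cond_pos | split]; intros t Ht.
  - assert (H : 0 < (f (a + (t - a)) - f a) / (t - a)).
    { apply Hsign; [lra | rewrite Rabs_pos_eq; lra]. }
    replace (a + (t - a)) with t in H by ring.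
    apply (Rmult_lt_compat_r (t - a)) in H; [|lra].
    replace ((f t - f a) / (t - a) * (t - a)) with (f t - f a) in H
      by (field; lra).
    lra.
  - assert (H : 0 < (f (a + (t - a)) - f a) / (t - a)).
    { apply Hsign; [lra | rewrite Rabs_left; lra]. }
    replace (a + (t - a)) with t in H by ring.
    apply (Rmult_lt_compat_r (a - t)) in H; [|lra].
    replace ((f t - f a) / (t - a) * (a - t)) with (f a - f t) in H
      by (field; lra).
    lra.
Qed.

Lemma positive_near (f : R -> R) (a : R) :
  continuity f -> 0 < f a ->
  exists d, 0 < d /\ forall t, Rabs (t - a) < d -> 0 < f t.
Proof.
  intros Hf Ha.
  destruct (Hf a (f a) Ha) as [d [Hd H]].
  exists d; split; [exact Hd|]; intros t Ht.
  destruct (Req_dec t a) as [->|Hne]; [exact Ha|].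
  assert (H1 : R_dist (f t) (f a) < f a).
  { apply H; split; [split; [exact I | congruence] | exact Ht]. }
  apply Rabs_def2 in H1; lra.
Qed.

(** A continuous function leaving zero upwards stays positive up to its next
    zero: c is the supremum of the times up to which f has remained positive. *)
Lemma first_zero (f : R -> R) (a b l : R) :
  continuity f -> f a = 0 -> is_derive f a l -> 0 < l -> a < b -> f b = 0 ->
  exists c, a < c /\ f c = 0 /\ forall t, a < t < c -> 0 < f t.
Proof.
  intros Hc Ha Hd Hl Hab Hb.
  destruct (locally_increasing f a l Hd Hl) as [d [Hd0 [Hr _]]].
  rewrite Ha in Hr.
  set (E := fun t => a < t /\ forall s, a < s <= t -> 0 < f s).
  assert (HEb : forall t, E t -> t < b).
  { intros t [_ Ht2]; destruct (Rlt_le_dec t b) as [|Hbt]; [assumption|].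
    specialize (Ht2 b (conj Hab Hbt)); lra. }
  assert (HE : E (a + d / 2)).
  { split; [lra | intros s Hs; apply Hr; lra]. }
  destruct (completeness E) as [c [Hub Hlub]].
  { exists b; intros t Ht; apply Rlt_le, HEb, Ht. }
  { now exists (a + d / 2). }
  pose proof (Hub _ HE) as Hac.
  assert (Hpos : forall t, a < t < c -> 0 < f t).
  { intros t Ht.
    destruct (classic (exists u, E u /\ t <= u)) as [[u [[_ Hu] Htu]] | Hno].
    - apply Hu; lra.
    - exfalso; assert (c <= t); [|lra].
      apply Hlub; intros u Hu.
      destruct (Rle_dec u t) as [|Hn]; [assumption|].
      exfalso; apply Hno; exists u; split; [assumption | lra]. }
  exists c; split; [lra | split; [|exact Hpos]].
  destruct (Rtotal_order (f c) 0) as [Hlt | [Heq | Hgt]]; [|exact Heq|].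
  - exfalso.
    destruct (positive_near (fun t => - f t) c) as [e [He Hn]];
      [now apply continuity_opp | lra |].
    set (t := Rmax (a + d / 4) (c - e / 2)).
    assert (a + d / 4 <= t) by apply Rmax_l.
    assert (c - e / 2 <= t) by apply Rmax_r.
    assert (t < c) by (apply Rmax_lub_lt; lra).
    assert (0 < f t) by (apply Hpos; lra).
    assert (0 < - f t) by (apply Hn; rewrite Rabs_left; lra).
    lra.
  - exfalso.
    destruct (positive_near f c Hc Hgt) as [e [He Hn]].
    assert (E (c + e / 2)).
    { split; [lra|]; intros s Hs.
      destruct (Rlt_le_dec s c); [apply Hpos; lra | apply Hn].
      rewrite Rabs_pos_eq; lra. }
    specialize (Hub _ H); lra.
Qed.

Lemma compact_max (K : R -> Prop) (f : R -> R) :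
  continuity f -> compact K -> (exists t, K t) ->
  exists m, K m /\ forall t, K t -> f t <= f m.
Proof.
  intros Hf HK [t0 Ht0].
  pose proof (continuity_compact f K Hf HK) as HI.
  destruct (compact_P1 _ HI) as [lo [hi Hb]].
  destruct (completeness (image_dir f K)) as [M [Hub Hlub]].
  { exists hi; intros y Hy; now apply Hb. }
  { exists (f t0), t0; now split. }
  assert (HM : image_dir f K M).
  { apply (adherence_P2 _ (compact_P2 _ HI)).
    intros V [d Hd].
    destruct (classic (exists y, image_dir f K y /\ M - d < y)) as [[y [Hy Hlt]] | Hno].
    - exists y; split; [|exact Hy]; apply Hd.
      specialize (Hub _ Hy); pose proof (cond_pos d).
      unfold disc; apply Rabs_def1; lra.
    - exfalso; pose proof (cond_pos d).
      assert (M <= M - d); [|lra].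
      apply Hlub; intros y Hy; destruct (Rle_dec y (M - d)); [assumption|].
      exfalso; apply Hno; exists y; split; [assumption | lra]. }
  destruct HM as [m [-> Hm]]; exists m; split; [exact Hm|].
  intros t Ht; apply Hub; now exists t.
Qed.

Lemma closed_nonneg (f : R -> R) : continuity f -> closed_set (fun t => 0 <= f t).
Proof.
  intros Hf t Ht.
  destruct (positive_near (fun s => - f s) t) as [d [Hd H]].
  - now apply continuity_opp.
  - unfold complementary in Ht; lra.
  - exists (mkposreal d Hd); intros s Hs.
    unfold disc in Hs; simpl in Hs; specialize (H s Hs).
    unfold complementary; lra.
Qed.

Lemma closed_inter (A B : R -> Prop) :
  closed_set A -> closed_set B -> closed_set (fun t => A t /\ B t).
Proof.
  intros HA HB t Ht.
  destruct (classic (A t)) as [H|H].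
  - destruct (HB t) as [d Hd]; [intros H'; now apply Ht|].
    exists d; intros u Hu [_ Hu']; now apply (Hd u Hu).
  - destruct (HA t H) as [d Hd].
    exists d; intros u Hu [Hu' _]; now apply (Hd u Hu).
Qed.

Lemma closed_zero (f : R -> R) : continuity f -> closed_set (fun t => f t = 0).
Proof.
  intros Hf t Ht; unfold complementary in *.
  destruct (positive_near (fun s => f s * f s) t) as [d [Hd H]].
  - now apply continuity_mult.
  - now apply Rsqr_pos_lt.
  - exists (mkposreal d Hd); intros s Hs E.
    specialize (H s Hs); rewrite E in H; lra.
Qed.

(** * Arcs that are graphs over the y-axis *)

Lemma continuous_inverse (f g : R -> R) :
  (forall s t, s < t -> f s < f t) -> (forall v, f (g v) = v) -> continuity g.
Proof.
  intros Hinc Hfg v e He.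
  assert (Hlo : f (g v - e) < v) by (rewrite <- (Hfg v) at 2; apply Hinc; lra).
  assert (Hhi : v < f (g v + e)) by (rewrite <- (Hfg v) at 1; apply Hinc; lra).
  exists (Rmin (v - f (g v - e)) (f (g v + e) - v)); split.
  - apply Rmin_pos; lra.
  - intros w [_ Hw]; simpl in Hw; unfold R_dist in Hw.
    pose proof (Rmin_l (v - f (g v - e)) (f (g v + e) - v)).
    pose proof (Rmin_r (v - f (g v - e)) (f (g v + e) - v)).
    apply Rabs_def2 in Hw.
    assert (Hcmp : forall s t, f s < f t -> s < t).
    { intros s t Hst; destruct (Rtotal_order s t) as [|[->|Hgt]]; [assumption|lra|].
      apply Hinc in Hgt; lra. }
    simpl; unfold R_dist; apply Rabs_def1.
    + assert (g w < g v + e) by (apply Hcmp; rewrite Hfg; lra); lra.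
    + assert (g v - e < g w) by (apply Hcmp; rewrite Hfg; lra); lra.
Qed.

(** Extending y beyond [a, b] with slope 1 turns it into an increasing bijection
    of the line, so that the function X is continuous everywhere and the end
    points of the arc need no separate treatment. *)
Lemma graph_of_arc (x y : R -> R) (a b : R) :
  a <= b -> continuity x -> continuity y ->
  (forall s t, a <= s -> s < t -> t <= b -> y s < y t) ->
  exists X, continuity X /\ forall t, a <= t <= b -> X (y t) = x t.
Proof.
  intros Hab Hx Hy Hinc.
  set (cl := fun t => Rmax a (Rmin t b)).
  assert (Hcl : forall t, a <= t <= b -> cl t = t).
  { intros t Ht; unfold cl; rewrite Rmin_left, Rmax_right; lra. }
  assert (Hlo : forall t, t <= a -> cl t = a).
  { intros t Ht; unfold cl; rewrite Rmin_left, Rmax_left; lra. }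
  assert (Hhi : forall t, b <= t -> cl t = b).
  { intros t Ht; unfold cl; rewrite Rmin_right, Rmax_right; lra. }
  set (Y := fun t => y (cl t) + (t - cl t)).
  assert (HY : forall t, a <= t <= b -> Y t = y t).
  { intros t Ht; unfold Y; rewrite Hcl by exact Ht; ring. }
  assert (HYinc : forall s t, s < t -> Y s < Y t).
  { intros s t Hst; unfold Y.
    assert (Hm : cl s = cl t /\ s < t \/
                 a <= cl s /\ cl s < cl t /\ cl t <= b /\ s - cl s <= t - cl t).
    { unfold cl, Rmax, Rmin; repeat destruct (Rle_dec _ _); lra. }
    destruct Hm as [[-> ?] | [H1 [H2 [H3 H4]]]]; [lra|].
    specialize (Hinc _ _ H1 H2 H3); lra. }
  assert (Hsur : forall v, {t | Y t = v}).
  { intros v; destruct (Rle_dec v (y a)) as [H1|H1].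
    - exists (a + (v - y a)); unfold Y; rewrite Hlo by lra; ring.
    - destruct (Rle_dec (y b) v) as [H2|H2].
      + exists (b + (v - y b)); unfold Y; rewrite Hhi by lra; ring.
      + destruct (IVT_gen y a b v Hy) as [t [Ht E]].
        * rewrite Rmin_left, Rmax_right; lra.
        * rewrite Rmin_left, Rmax_right in Ht by lra.
          exists t; rewrite HY; assumption. }
  set (g := fun v => proj1_sig (Hsur v)).
  assert (Hg : forall v, Y (g v) = v) by (intros v; exact (proj2_sig (Hsur v))).
  exists (fun v => x (g v)); split.
  - apply (continuity_comp g x); [|exact Hx].
    now apply (continuous_inverse Y).
  - intros t Ht; f_equal.
    assert (E : Y (g (y t)) = Y t) by (rewrite Hg, HY; auto).
    destruct (Rtotal_order (g (y t)) t) as [H|[H|H]]; [|exact H|];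
      apply HYinc in H; lra.
Qed.

(** Over the heights of a falling arc, a second arc that passes from one side of
    it to the other meets it: the horizontal distance from the second arc to the
    first is a continuous function of the parameter of the second. *)
Lemma arcs_cross (x y : R -> R) (a b c d s1 s2 : R) :
  continuity x -> continuity y -> a <= b ->
  (forall s t, a <= s -> s < t -> t <= b -> y t < y s) ->
  c <= d -> (forall t, c <= t <= d -> y b <= y t <= y a) ->
  a <= s1 <= b -> y s1 = y c -> x s1 <= x c ->
  a <= s2 <= b -> y s2 = y d -> x d <= x s2 ->
  exists s t, a <= s <= b /\ c <= t <= d /\ x s = x t /\ y s = y t.
Proof.
  intros Hx Hy Hab Hdec Hcd Hrange Hs1 Ey1 Hx1 Hs2 Ey2 Hx2.
  destruct (graph_of_arc x (fun t => - y t) a b Hab Hx) as [X [HX HXy]].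
  { now apply continuity_opp. }
  { intros s t H1 H2 H3; specialize (Hdec s t H1 H2 H3); lra. }
  set (phi := fun t => X (- y t) - x t).
  assert (Hphi : continuity phi).
  { apply continuity_minus; [|exact Hx].
    apply (continuity_comp (fun t => - y t) X); [now apply continuity_opp | exact HX]. }
  destruct (IVT_gen phi c d 0 Hphi) as [t [Ht E]].
  { assert (phi c <= 0) by (unfold phi; rewrite <- Ey1, HXy; lra).
    assert (0 <= phi d) by (unfold phi; rewrite <- Ey2, HXy; lra).
    rewrite Rmin_left, Rmax_right; lra. }
  rewrite Rmin_left, Rmax_right in Ht by lra.
  pose proof (Hrange t Ht) as Hyt.
  destruct (IVT_gen y a b (y t) Hy) as [s [Hs Es]].
  { rewrite Rmin_right, Rmax_left; lra. }
  rewrite Rmin_left, Rmax_right in Hs by lra.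
  exists s, t; repeat split; try lra.
  unfold phi in E; rewrite <- Es, HXy in E; lra.
Qed.

(** At a bottom N passed from left to right, the rising branch starts to the right
    of the falling one, and it stays there because the branches do not meet. *)
Lemma fold_opens (x y : R -> R) (a N b l : R) :
  continuity x -> continuity y ->
  (forall s t, a <= s -> s < t -> t <= N -> y t < y s) ->
  (forall s t, N <= s -> s < t -> t <= b -> y s < y t) ->
  is_derive x N l -> 0 < l ->
  (forall s t, a <= s < N -> N < t <= b -> x s = x t -> y s = y t -> False) ->
  forall s t, a <= s < N -> N < t <= b -> y s = y t -> x s < x t.
Proof.
  intros Hx Hy Hdec Hinc Hd Hl Hno s0 t0 Hs0 Ht0 E0.
  destruct (Rlt_le_dec (x s0) (x t0)) as [|Hle]; [assumption | exfalso].
  destruct (locally_increasing x N l Hd Hl) as [d [Hd0 [Hr Hl']]].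
  (* A level slightly above the bottom, low enough for both of its points to lie
     where x is compared with x N. *)
  set (s1 := Rmax s0 (N - d / 2)).
  assert (s0 <= s1) by apply Rmax_l.
  assert (N - d / 2 <= s1) by apply Rmax_r.
  assert (s1 < N) by (apply Rmax_lub_lt; lra).
  assert (y N < y s1) by (apply Hdec; lra).
  destruct (positive_near (fun t => y s1 - y t) N) as [e [He Hnear]].
  { apply continuity_minus; [apply continuity_const; easy | exact Hy]. }
  { lra. }
  set (t1 := N + Rmin (e / 2) (Rmin (d / 2) (t0 - N))).
  assert (Ht1 : N < t1 /\ t1 < N + e /\ t1 < N + d /\ t1 <= t0).
  { unfold t1, Rmin; repeat destruct (Rle_dec _ _); lra. }
  destruct Ht1 as [Ht1 [Ht1e [Ht1d Ht1t]]].
  assert (y t1 < y s1).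
  { assert (0 < y s1 - y t1); [|lra].
    apply Hnear; rewrite Rabs_pos_eq; lra. }
  assert (HyN : y N < y t1) by (apply Hinc; lra).
  destruct (IVT_gen y s1 N (y t1) Hy) as [s' [Hs' Es']].
  { rewrite Rmin_right, Rmax_left; lra. }
  rewrite Rmin_left, Rmax_right in Hs' by lra.
  assert (s' < N).
  { destruct (Req_dec s' N) as [->|]; lra. }
  destruct (arcs_cross x y s0 N t1 t0 s' s0) as [s [t [Hs [Ht [Ex Ey]]]]];
    try assumption; try lra.
  - intros s t Ha Hst Hb; apply Hdec; lra.
  - intros t Ht; split.
    + apply Rlt_le, Hinc; lra.
    + rewrite E0; destruct (Req_dec t t0) as [->|]; [lra|].
      apply Rlt_le, Hinc; lra.
  - assert (x s' < x N) by (apply Hl'; lra).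
    assert (x N < x t1) by (apply Hr; lra). lra.
  - apply (Hno s t); try lra; split; try lra.
    destruct (Req_dec s N) as [->|]; [|lra].
    assert (y N < y t) by (apply Hinc; lra). lra.
Qed.

(** * Locally convex loops *)

(** The derivatives are separate functions, rather than iterated [Derive], so that
    the images of a loop under symmetries are again loops by plain substitution. *)
Record locally_convex_loop (x y x1 y1 x2 y2 : R -> R) (L : R) : Prop := {
  loop_period_pos : 0 < L;
  loop_dx : forall t, is_derive x t (x1 t);
  loop_dy : forall t, is_derive y t (y1 t);
  loop_ddx : forall t, is_derive x1 t (x2 t);
  loop_ddy : forall t, is_derive y1 t (y2 t);
  loop_px : forall t, x (t + L) = x t;
  loop_py : forall t, y (t + L) = y t;
  loop_curv : forall t, 0 < x1 t * y2 t - y1 t * x2 t;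
  loop_simple : forall s t, s < t < s + L -> x s = x t -> y s = y t -> False }.

Lemma derive_opp_arg (f : R -> R) (t l : R) :
  is_derive f (- t) l -> is_derive (fun s => f (- s)) t (- l).
Proof.
  intros H; replace (- l) with (scal (- 1) l) by (unfold scal; simpl; unfold mult; simpl; ring).
  apply (is_derive_comp f Ropp t l (- 1) H).
  auto_derive; [trivial | ring].
Qed.

Lemma derive_lincomb (f g : R -> R) (p q t lf lg : R) :
  is_derive f t lf -> is_derive g t lg ->
  is_derive (fun s => p * f s + q * g s) t (p * lf + q * lg).
Proof.
  intros Hf Hg; apply (is_derive_plus (fun s => p * f s) (fun s => q * g s));
    now apply is_derive_scal.
Qed.

Lemma derive_periodic (f f' : R -> R) (L : R) :
  (forall t, is_derive f t (f' t)) -> (forall t, f (t + L) = f t) ->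
  forall t, f' (t + L) = f' t.
Proof.
  intros Hf Hp t.
  assert (H : is_derive (fun s => f (s + L)) t (f' (t + L))).
  { replace (f' (t + L)) with (scal 1 (f' (t + L)))
      by (unfold scal; simpl; unfold mult; simpl; ring).
    apply (is_derive_comp f (fun s => s + L) t (f' (t + L)) 1 (Hf _)).
    auto_derive; [trivial | ring]. }
  apply (is_derive_ext _ f) in H; [|exact Hp].
  apply is_derive_unique in H; rewrite <- H; apply is_derive_unique, Hf.
Qed.

Lemma periodic_Z {A : Type} (f : R -> A) (L : R) :
  (forall t, f (t + L) = f t) -> forall (n : Z) t, f (t + IZR n * L) = f t.
Proof.
  intros Hp.
  assert (Hn : forall (n : nat) t, f (t + INR n * L) = f t).
  { induction n as [|n IH]; intros t.
    - f_equal; simpl; ring.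
    - rewrite S_INR; replace (t + (INR n + 1) * L) with (t + INR n * L + L) by ring.
      now rewrite Hp. }
  intros n t; destruct (Z.le_gt_cases 0 n) as [H|H].
  - rewrite <- (Z2Nat.id n H), <- INR_IZR_INZ; apply Hn.
  - rewrite <- (Hn (Z.to_nat (- n)) (t + IZR n * L)); f_equal.
    rewrite INR_IZR_INZ, Z2Nat.id, opp_IZR by lia; ring.
Qed.

Lemma shift_to_period (L a t : R) :
  0 < L -> exists n : Z, a <= t + IZR n * L < a + L.
Proof.
  intros HL.
  destruct (base_Int_part ((t - a) / L)) as [H1 H2].
  set (k := Int_part ((t - a) / L)) in *.
  exists (- k)%Z; rewrite opp_IZR.
  assert (E : t - a = (t - a) / L * L) by (field; lra).
  assert (IZR k * L <= t - a) by (rewrite E; apply Rmult_le_compat_r; lra).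
  assert (t - a < (IZR k + 1) * L) by (rewrite E at 1; apply Rmult_lt_compat_r; lra).
  lra.
Qed.

(** A mirror reverses the sign of the curvature, and so does a change of the
    direction of travel; doing both preserves it. *)
Lemma reflect_loop (x y x1 y1 x2 y2 : R -> R) (L : R) :
  locally_convex_loop x y x1 y1 x2 y2 L ->
  locally_convex_loop (fun t => - x (- t)) (fun t => y (- t))
    (fun t => x1 (- t)) (fun t => - y1 (- t))
    (fun t => - x2 (- t)) (fun t => y2 (- t)) L.
Proof.
  intros [HL Hx Hy Hx1 Hy1 Px Py Hk Hs]; split.
  - exact HL.
  - intros t; rewrite <- (Ropp_involutive (x1 (- t))).
    apply @is_derive_opp; now apply (derive_opp_arg x).
  - intros t; now apply (derive_opp_arg y).
  - intros t; now apply (derive_opp_arg x1).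
  - intros t; rewrite <- (Ropp_involutive (y2 (- t))).
    apply @is_derive_opp; now apply (derive_opp_arg y1).
  - intros t; rewrite <- (Px (- (t + L))); do 2 f_equal; ring.
  - intros t; rewrite <- (Py (- (t + L))); f_equal; ring.
  - intros t; specialize (Hk (- t)); lra.
  - intros s t Hst Ex Ey; apply (Hs (- t) (- s)); lra.
Qed.

Lemma rotate_loop (p q : R) (x y x1 y1 x2 y2 : R -> R) (L : R) :
  0 < p * p + q * q ->
  locally_convex_loop x y x1 y1 x2 y2 L ->
  locally_convex_loop
    (fun t => p * x t + q * y t) (fun t => - q * x t + p * y t)
    (fun t => p * x1 t + q * y1 t) (fun t => - q * x1 t + p * y1 t)
    (fun t => p * x2 t + q * y2 t) (fun t => - q * x2 t + p * y2 t) L.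
Proof.
  intros Hpq [HL Hx Hy Hx1 Hy1 Px Py Hk Hs]; split;
    try (intros t; now apply derive_lincomb).
  - exact HL.
  - intros t; now rewrite Px, Py.
  - intros t; now rewrite Px, Py.
  - intros t; specialize (Hk t).
    replace (_ - _) with ((p * p + q * q) * (x1 t * y2 t - y1 t * x2 t)) by ring.
    now apply Rmult_lt_0_compat.
  - intros s t Hst Ex Ey; apply (Hs s t Hst);
      apply (Rmult_eq_reg_l (p * p + q * q)); try lra.
    + replace ((p * p + q * q) * x s)
        with (p * (p * x s + q * y s) - q * (- q * x s + p * y s)) by ring.
      rewrite Ex, Ey; ring.
    + replace ((p * p + q * q) * y s)
        with (q * (p * x s + q * y s) + p * (- q * x s + p * y s)) by ring.
      rewrite Ex, Ey; ring.
Qed.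

Lemma opp_loop (x y x1 y1 x2 y2 : R -> R) (L : R) :
  locally_convex_loop x y x1 y1 x2 y2 L ->
  locally_convex_loop (fun t => - x t) (fun t => - y t) (fun t => - x1 t)
    (fun t => - y1 t) (fun t => - x2 t) (fun t => - y2 t) L.
Proof.
  intros [HL Hx Hy Hx1 Hy1 Px Py Hk Hs]; split;
    try (intros t; now apply @is_derive_opp).
  - exact HL.
  - intros t; now rewrite Px.
  - intros t; now rewrite Py.
  - intros t; specialize (Hk t); lra.
  - intros s t Hst Ex Ey; apply (Hs s t Hst); lra.
Qed.

(** After a bottom the curve rises until its velocity is horizontal again.  There
    y' falls to zero, so y'' <= 0, and positive curvature makes x' negative. *)
Lemma next_top (x y x1 y1 x2 y2 : R -> R) (L N : R) :
  locally_convex_loop x y x1 y1 x2 y2 L -> y1 N = 0 -> 0 < x1 N ->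
  exists M, N < M /\ y1 M = 0 /\ x1 M < 0 /\ forall t, N < t < M -> 0 < y1 t.
Proof.
  intros [HL Hx Hy Hx1 Hy1 Px Py Hk Hs] HN HxN.
  assert (Hy2N : 0 < y2 N).
  { specialize (Hk N); rewrite HN in Hk.
    apply (Rmult_lt_reg_l (x1 N)); lra. }
  destruct (first_zero y1 N (N + L) (y2 N)) as [M [HNM [HM Hpos]]]; try lra.
  - now apply (continuity_of_derive y1 y2).
  - apply Hy1.
  - rewrite (derive_periodic y y1 L Hy Py); exact HN.
  - exists M; repeat split; try assumption.
    assert (Hy2M : y2 M <= 0).
    { destruct (Rle_dec (y2 M) 0) as [|H]; [assumption|].
      destruct (locally_increasing y1 M (y2 M) (Hy1 M)) as [d [Hd [_ Hl]]]; [lra|].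
      set (t := Rmax ((N + M) / 2) (M - d / 2)).
      assert ((N + M) / 2 <= t) by apply Rmax_l.
      assert (M - d / 2 <= t) by apply Rmax_r.
      assert (t < M) by (apply Rmax_lub_lt; lra).
      assert (0 < y1 t) by (apply Hpos; lra).
      assert (y1 t < y1 M) by (apply Hl; lra). lra. }
    specialize (Hk M); rewrite HM in Hk.
    destruct (Rlt_le_dec (x1 M) 0) as [|H]; [assumption|].
    assert (0 <= x1 M * - y2 M) by (apply Rmult_le_pos; lra). lra.
Qed.

(** * Simple locally convex loops are convex *)

(** The loop cannot pass from a top M down to a highest bottom N, above its lowest
    level, and up to a top M2 no higher than M.  From M2 the curve would fall
    inside the pocket formed by the branches from M to N and from N to M2, and
    would have to leave this pocket through one of them in order to come down to
    the height of N. *)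
Lemma spiral_in (x y x1 y1 x2 y2 : R -> R) (L M N M2 P : R) :
  locally_convex_loop x y x1 y1 x2 y2 L ->
  M < N -> y1 N = 0 -> 0 < x1 N -> (forall t, M < t < N -> y1 t < 0) ->
  N < M2 -> y1 M2 = 0 -> x1 M2 < 0 -> (forall t, N < t < M2 -> 0 < y1 t) ->
  y M2 <= y M ->
  (forall t, y1 t = 0 -> 0 < x1 t -> y t <= y N) ->
  y P < y N -> False.
Proof.
  intros HC HMN HyN HxN Hneg HNM2 HyM2 HxM2 Hpos HM Hhigh HP.
  destruct (next_top _ _ _ _ _ _ L M2 (opp_loop _ _ _ _ _ _ _ HC))
    as [N2 [HMN2 [HyN2 [HxN2 Hneg2]]]]; [lra | lra |].
  destruct HC as [HL Hx Hy Hx1 Hy1 Px Py Hk Hs].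
  assert (Hdec : forall s t, M <= s -> s < t -> t <= N -> y t < y s).
  { intros s t H1 H2 H3.
    assert (- y s < - y t); [|lra].
    apply (strictly_increasing_of_derive (fun t => - y t) (fun t => - y1 t) M N); try assumption.
    - intros u; now apply @is_derive_opp.
    - intros u Hu; specialize (Hneg u Hu); lra. }
  assert (Hinc : forall s t, N <= s -> s < t -> t <= M2 -> y s < y t)
    by now apply (strictly_increasing_of_derive y y1).
  assert (Hdec2 : forall s t, M2 <= s -> s < t -> t <= N2 -> y t < y s).
  { intros s t H1 H2 H3.
    assert (- y s < - y t); [|lra].
    apply (strictly_increasing_of_derive (fun t => - y t) (fun t => - y1 t) M2 N2); try assumption.
    intros u; now apply @is_derive_opp. }
  assert (HN2 : y N2 <= y N) by (apply Hhigh; lra).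
  pose proof (derive_periodic x x1 L Hx Px) as Px1.
  pose proof (derive_periodic y y1 L Hy Py) as Py1.
  (* The bottom N2 comes before N + L; otherwise the part from N to M2 and down to
     N + L would be the whole curve, which has a point below N. *)
  assert (HNL : N2 < N + L).
  { destruct (Rlt_le_dec N2 (N + L)) as [|Hle]; [assumption | exfalso].
    assert (EN : y1 (N + L) = 0) by (rewrite Py1; exact HyN).
    assert (HxNL : 0 < x1 (N + L)) by (rewrite Px1; exact HxN).
    assert (N2 = N + L).
    { destruct (Rtotal_order (N + L) M2) as [H|[H|H]].
      - specialize (Hpos (N + L)); lra.
      - rewrite <- H in HxM2; lra.
      - destruct (Req_dec N2 (N + L)); [assumption|].
        specialize (Hneg2 (N + L)); lra. }
    subst N2.
    destruct (shift_to_period L N P HL) as [n Hn].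
    assert (y (P + IZR n * L) = y P) by (apply periodic_Z; exact Py).
    set (Q := P + IZR n * L) in *.
    destruct (Rle_dec Q M2).
    - destruct (Req_dec Q N) as [E|]; [rewrite E in *; lra|].
      assert (y N < y Q) by (apply Hinc; lra). lra.
    - assert (y (N + L) < y Q) by (apply Hdec2; lra).
      rewrite Py in *; lra. }
  (* So the arc from M to N2 is no longer than a period, and its points are
     distinct except possibly for the two ends. *)
  assert (HN2M : N2 - L <= M).
  { destruct (Rle_dec (N2 - L) M) as [|H]; [assumption | exfalso].
    assert (y1 (N2 - L) = 0).
    { rewrite <- Py1; replace (N2 - L + L) with N2 by ring; lra. }
    specialize (Hneg (N2 - L)); lra. }
  assert (Hcx : continuity x) by now apply (continuity_of_derive x x1).
  assert (Hcy : continuity y) by now apply (continuity_of_derive y y1).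
  assert (HyNM2 : y N < y M2) by (apply Hinc; lra).
  (* Compare the branches at the height of M2, by the fold at N. *)
  destruct (IVT_gen y M N (y M2) Hcy) as [s1 [Hs1 Es1]].
  { rewrite Rmin_right, Rmax_left; lra. }
  rewrite Rmin_left, Rmax_right in Hs1 by lra.
  assert (Hs1N : s1 < N) by (destruct (Req_dec s1 N) as [->|]; lra).
  assert (HA : x s1 < x M2).
  { apply (fold_opens x y M N M2 (x1 N)); try assumption; try lra; try apply Hx.
    intros s t H1 H2; apply Hs; lra. }
  (* Compare the branches at the height of N, by the fold at M2, which is a bottom
     of the loop turned upside down. *)
  destruct (IVT_gen y M2 N2 (y N) Hcy) as [t2 [Ht2 Et2]].
  { rewrite Rmin_right, Rmax_left; lra. }
  rewrite Rmin_left, Rmax_right in Ht2 by lra.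
  assert (HM2t2 : M2 < t2) by (destruct (Req_dec t2 M2) as [->|]; lra).
  assert (HB : - x N < - x t2).
  { apply (fold_opens (fun t => - x t) (fun t => - y t) N M2 N2 (- x1 M2));
      try (now apply continuity_opp); try lra.
    - intros s t H1 H2 H3; assert (y s < y t) by (apply Hinc; lra); lra.
    - intros s t H1 H2 H3; assert (y t < y s) by (apply Hdec2; lra); lra.
    - apply @is_derive_opp, Hx.
    - intros s t H1 H2 E1 E2; apply (Hs s t); lra. }
  destruct (arcs_cross x y M N M2 t2 s1 N) as [s [t [H1 [H2 [Ex Ey]]]]];
    try assumption; try lra.
  - intros t Ht; split.
    + rewrite <- Et2; destruct (Req_dec t t2) as [->|]; [lra|].
      apply Rlt_le, Hdec2; lra.
    + destruct (Req_dec t M2) as [->|]; [lra|].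
      assert (y t < y M2) by (apply Hdec2; lra); lra.
  - apply (Hs s t); try assumption; split; [lra|].
    destruct (Req_dec s M) as [->|]; [|lra].
    destruct (Req_dec t N2) as [->|]; [|lra].
    lra.
Qed.

(** A bottom above some other point would give a highest such bottom N, by
    compactness.  The lower of the two tops next to N comes after N either for the
    loop or for its mirror image traversed backwards. *)
Lemma bottom_is_lowest (x y x1 y1 x2 y2 : R -> R) (L t0 : R) :
  locally_convex_loop x y x1 y1 x2 y2 L -> y1 t0 = 0 -> 0 < x1 t0 ->
  forall s, y t0 <= y s.
Proof.
  intros HC Hy0 Hx0 P.
  destruct (Rle_dec (y t0) (y P)) as [|HP]; [assumption | exfalso].
  pose proof HC as [HL Hx Hy Hx1 Hy1 Px Py Hk Hs].
  pose proof (derive_periodic x x1 L Hx Px) as Px1.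
  pose proof (derive_periodic y y1 L Hy Py) as Py1.
  assert (Hcx1 : continuity x1) by now apply (continuity_of_derive x1 x2).
  assert (Hcy1 : continuity y1) by now apply (continuity_of_derive y1 y2).
  assert (Hcy : continuity y) by now apply (continuity_of_derive y y1).
  (* The condition 0 <= x1 t, unlike 0 < x1 t, is closed; the two agree where
     y1 t = 0. *)
  destruct (compact_max (fun t => 0 <= t <= L /\ y1 t = 0 /\ 0 <= x1 t) y Hcy)
    as [N [[_ [HyN HxN]] Hmax]].
  { apply (compact_P4 (fun t => 0 <= t <= L)); [apply compact_P3 | |].
    - apply closed_inter; [apply compact_P2, compact_P3 | apply closed_inter].
      + apply closed_zero, Hcy1.
      + apply closed_nonneg, Hcx1.
    - intros t [Ht _]; exact Ht. }
  { destruct (shift_to_period L 0 t0 HL) as [n Hn].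
    exists (t0 + IZR n * L); split; [lra|].
    rewrite (periodic_Z y1 L Py1), (periodic_Z x1 L Px1); lra. }
  assert (Hhigh : forall t, y1 t = 0 -> 0 < x1 t -> y t <= y N).
  { intros t H1 H2; destruct (shift_to_period L 0 t HL) as [n Hn].
    rewrite <- (periodic_Z y L Py n t); apply Hmax; split; [lra|].
    rewrite (periodic_Z y1 L Py1), (periodic_Z x1 L Px1); lra. }
  assert (HxN' : 0 < x1 N).
  { destruct (Req_dec (x1 N) 0) as [E|]; [|lra].
    specialize (Hk N); rewrite E, HyN in Hk; lra. }
  assert (HPN : y P < y N) by (specialize (Hhigh t0 Hy0 Hx0); lra).
  pose proof (reflect_loop _ _ _ _ _ _ _ HC) as HR.
  destruct (next_top _ _ _ _ _ _ L N HC HyN HxN') as [M2 [H1 [H2 [H3 H4]]]].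
  destruct (next_top _ _ _ _ _ _ L (- N) HR) as [M [H5 [H6 [H7 H8]]]];
    [rewrite Ropp_involutive; lra.. |].
  assert (Hneg : forall t, - M < t < N -> y1 t < 0).
  { intros t Ht; specialize (H8 (- t)); rewrite Ropp_involutive in H8; lra. }
  destruct (Rle_dec (y M2) (y (- M))) as [Hle|Hgt].
  - apply (spiral_in x y x1 y1 x2 y2 L (- M) N M2 P); try assumption; lra.
  - apply (spiral_in _ _ _ _ _ _ L (- M2) (- N) M (- P) HR);
      rewrite ?Ropp_involutive; try assumption; try lra.
    + intros t Ht; specialize (H4 (- t)); lra.
    + intros t E Hp; apply Hhigh; lra.
Qed.

(** Rotating the velocity at t to the positive horizontal direction makes t a
    bottom, and the height becomes the expression below up to a constant. *)
Lemma loop_left_of_tangents (x y x1 y1 x2 y2 : R -> R) (L : R) :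
  locally_convex_loop x y x1 y1 x2 y2 L ->
  forall t s, 0 <= x1 t * (y s - y t) - y1 t * (x s - x t).
Proof.
  intros HC t s.
  assert (Hpos : 0 < x1 t * x1 t + y1 t * y1 t).
  { pose proof (loop_curv _ _ _ _ _ _ _ HC t).
    destruct (Req_dec (x1 t) 0) as [E|E].
    - destruct (Req_dec (y1 t) 0) as [E'|E'].
      + rewrite E, E' in H; lra.
      + apply Rsqr_pos_lt in E'; unfold Rsqr in E'; rewrite E; lra.
    - apply Rsqr_pos_lt in E; unfold Rsqr in E.
      pose proof (Rle_0_sqr (y1 t)) as E'; unfold Rsqr in E'; lra. }
  pose proof (bottom_is_lowest _ _ _ _ _ _ L t (rotate_loop (x1 t) (y1 t) _ _ _ _ _ _ L Hpos HC))
    as H; simpl in H.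
  specialize (H ltac:(ring) Hpos s); lra.
Qed.

(** * Space curves over a convex loop *)

Lemma constant_of_zero_derive (f f' : R -> R) :
  (forall t, is_derive f t (f' t)) -> (forall t, f' t = 0) -> forall t, f t = f 0.
Proof.
  intros Hf H0.
  assert (H : forall s t, s < t -> f t = f s).
  { intros s t Hst; destruct (mean_value f f' s t Hf Hst) as [c [_ E]].
    rewrite H0 in E; lra. }
  intros t; destruct (Rtotal_order t 0) as [Ht|[->|Ht]]; [symmetry| |]; auto.
Qed.

Lemma derive_zero_of_periodic_monotone (f f' : R -> R) (L : R) :
  0 < L -> (forall t, is_derive f t (f' t)) -> (forall t, f (t + L) = f t) ->
  (forall t, 0 <= f' t) -> forall t, f' t = 0.
Proof.
  intros HL Hf Hp Hpos t.
  assert (Hmono : forall s u, s <= u -> f s <= f u).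
  { intros s u [Hsu| ->]; [|lra].
    destruct (mean_value f f' s u Hf Hsu) as [c [_ E]].
    assert (0 <= f' c * (u - s)) by (apply Rmult_le_pos; [apply Hpos | lra]). lra. }
  destruct (Hpos t) as [Ht|]; [exfalso | congruence].
  destruct (locally_increasing f t (f' t) (Hf t) Ht) as [d [Hd [Hr _]]].
  set (u := t + Rmin (d / 2) L).
  assert (t < u < t + d /\ u <= t + L)
    by (unfold u, Rmin; destruct (Rle_dec _ _); lra).
  assert (f t < f u) by (apply Hr; lra).
  assert (f u <= f (t + L)) by (apply Hmono; lra).
  rewrite Hp in *; lra.
Qed.

(** The triple product of the vectors (ui, vi, hi), that is, the numerator of the
    torsion when these are the first three derivatives of a curve. *)
Definition torsion_det (u1 v1 h1 u2 v2 h2 u3 v3 h3 : R) : R :=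
  (v1 * h2 - h1 * v2) * u3 + (h1 * u2 - u1 * h2) * v3 + (u1 * v2 - v1 * u2) * h3.

(** The height c of the osculating plane above the point (x 0, y 0) is periodic and
    has derivative lam S, a product of a function with the sign of the torsion and
    of one that is nonnegative by convexity. *)
Lemma planar_of_nonneg_torsion_det
  (x y x1 y1 x2 y2 x3 y3 h h1 h2 h3 : R -> R) (L : R) :
  locally_convex_loop x y x1 y1 x2 y2 L ->
  (forall t, is_derive x2 t (x3 t)) -> (forall t, is_derive y2 t (y3 t)) ->
  (forall t, is_derive h t (h1 t)) -> (forall t, is_derive h1 t (h2 t)) ->
  (forall t, is_derive h2 t (h3 t)) ->
  continuity x3 -> continuity y3 -> continuity h3 ->
  (forall t, h (t + L) = h t) ->
  let W t := torsion_det (x1 t) (y1 t) (h1 t) (x2 t) (y2 t) (h2 t) (x3 t) (y3 t) (h3 t) in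
  (forall t, 0 <= W t) ->
  (forall t, W t = 0) /\ exists a b c, forall t, h t = a * x t + b * y t + c.
Proof.
  intros HC Hx2 Hy2 Hh Hh1 Hh2 Cx3 Cy3 Ch3 Ph W HW.
  pose proof HC as [HL Hx Hy Hx1 Hy1 Px Py Hk _].
  pose proof (derive_periodic x x1 L Hx Px) as Px1.
  pose proof (derive_periodic y y1 L Hy Py) as Py1.
  pose proof (derive_periodic h h1 L Hh Ph) as Ph1.
  pose proof (derive_periodic x1 x2 L Hx1 Px1) as Px2.
  pose proof (derive_periodic y1 y2 L Hy1 Py1) as Py2.
  pose proof (derive_periodic h1 h2 L Hh1 Ph1) as Ph2.
  set (k := fun t => x1 t * y2 t - y1 t * x2 t) in *.
  set (a := fun t => (h1 t * y2 t - h2 t * y1 t) / k t).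
  set (b := fun t => (x1 t * h2 t - x2 t * h1 t) / k t).
  set (S := fun t => (x t - x 0) * y1 t - (y t - y 0) * x1 t).
  set (c := fun t => h t - a t * (x t - x 0) - b t * (y t - y 0)).
  set (lam := fun t => W t / (k t * k t)).
  assert (Hlam : forall t, 0 <= lam t).
  { intros t; apply Rdiv_le_0_compat; [apply HW|].
    apply Rmult_lt_0_compat; apply Hk. }
  assert (Hk0 : forall t, k t <> 0) by (intros t; apply Rgt_not_eq, Hk).
  assert (Da : forall t, is_derive a t (- lam t * y1 t)).
  { intros t; specialize (Hk0 t); unfold k in Hk0.
    unfold a, k; auto_derive.
    - repeat split; try (eexists; eauto; fail); exact Hk0.
    - rewrite (is_derive_unique (fun v : R => x1 v) _ _ (Hx1 t)), (is_derive_unique (fun v : R => y1 v) _ _ (Hy1 t)),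
        (is_derive_unique (fun v : R => h1 v) _ _ (Hh1 t)), (is_derive_unique (fun v : R => x2 v) _ _ (Hx2 t)),
        (is_derive_unique (fun v : R => y2 v) _ _ (Hy2 t)), (is_derive_unique (fun v : R => h2 v) _ _ (Hh2 t)).
      unfold lam, W, torsion_det, k; field; exact Hk0. }
  assert (Db : forall t, is_derive b t (lam t * x1 t)).
  { intros t; specialize (Hk0 t); unfold k in Hk0.
    unfold b, k; auto_derive.
    - repeat split; try (eexists; eauto; fail); exact Hk0.
    - rewrite (is_derive_unique (fun v : R => x1 v) _ _ (Hx1 t)), (is_derive_unique (fun v : R => y1 v) _ _ (Hy1 t)),
        (is_derive_unique (fun v : R => h1 v) _ _ (Hh1 t)), (is_derive_unique (fun v : R => x2 v) _ _ (Hx2 t)),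
        (is_derive_unique (fun v : R => y2 v) _ _ (Hy2 t)), (is_derive_unique (fun v : R => h2 v) _ _ (Hh2 t)).
      unfold lam, W, torsion_det, k; field; exact Hk0. }
  assert (Dc : forall t, is_derive c t (lam t * S t)).
  { intros t; specialize (Hk0 t).
    unfold c; auto_derive.
    - repeat split; try (eexists; eauto; fail).
    - rewrite (is_derive_unique (fun v : R => x v) _ _ (Hx t)), (is_derive_unique (fun v : R => y v) _ _ (Hy t)),
        (is_derive_unique (fun v : R => h v) _ _ (Hh t)), (is_derive_unique (fun v : R => a v) _ _ (Da t)),
        (is_derive_unique (fun v : R => b v) _ _ (Db t)).
      unfold S, a, b; unfold k in *; field; exact Hk0. }
  assert (HS : forall t, 0 <= S t).
  { intros t; pose proof (loop_left_of_tangents _ _ _ _ _ _ L HC t 0).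
    unfold S; lra. }
  assert (HlS : forall t, lam t * S t = 0).
  { apply (derive_zero_of_periodic_monotone c _ L HL Dc).
    - intros t; unfold c, a, b, k.
      now rewrite Px, Py, Ph, Px1, Py1, Ph1, Px2, Py2, Ph2.
    - intros t; now apply Rmult_le_pos. }
  assert (CW : continuity W).
  { assert (continuity x1) by now apply (continuity_of_derive x1 x2).
    assert (continuity y1) by now apply (continuity_of_derive y1 y2).
    assert (continuity h1) by now apply (continuity_of_derive h1 h2).
    assert (continuity x2) by now apply (continuity_of_derive x2 x3).
    assert (continuity y2) by now apply (continuity_of_derive y2 y3).
    assert (continuity h2) by now apply (continuity_of_derive h2 h3).
    change (continuity ((y1 * h2 - h1 * y2) * x3 + (h1 * x2 - x1 * h2) * y3
                        + (x1 * y2 - y1 * x2) * h3)%F).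
    repeat lazymatch goal with
      | |- continuity (_ + _)%F => apply continuity_plus
      | |- continuity (_ - _)%F => apply continuity_minus
      | |- continuity (_ * _)%F => apply continuity_mult
      end; assumption. }
  assert (HW0 : forall t, W t = 0).
  { intros t; destruct (HW t) as [Ht|]; [exfalso | congruence].
    destruct (positive_near W t CW Ht) as [d [Hd Hnear]].
    assert (HS0 : forall u, Rabs (u - t) < d -> S u = 0).
    { intros u Hu; specialize (Hnear u Hu).
      destruct (Rmult_integral _ _ (HlS u)) as [E|]; [|assumption].
      assert (0 < lam u); [|lra].
      apply Rdiv_lt_0_compat; [assumption | apply Rmult_lt_0_compat; apply Hk]. }
    (* Since S = 0 near t, its derivative is 0 there as well. *)
    assert (DS : forall u, Rabs (u - t) < d ->
                   (x u - x 0) * y2 u - (y u - y 0) * x2 u = 0).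
    { intros u Hu.
      assert (H : is_derive S u ((x u - x 0) * y2 u - (y u - y 0) * x2 u)).
      { unfold S; auto_derive.
        - repeat split; eexists; eauto.
        - rewrite (is_derive_unique (fun v : R => x v) _ _ (Hx u)), (is_derive_unique (fun v : R => y v) _ _ (Hy u)),
            (is_derive_unique (fun v : R => x1 v) _ _ (Hx1 u)), (is_derive_unique (fun v : R => y1 v) _ _ (Hy1 u)); ring. }
      assert (H0 : is_derive S u 0).
      { apply (is_derive_ext_loc (fun _ => 0)); [|apply @is_derive_const].
        exists (mkposreal (d - Rabs (u - t)) ltac:(lra)); intros v Hv.
        symmetry; apply HS0.
        replace (v - t) with ((v - u) + (u - t)) by ring.
        eapply Rle_lt_trans; [apply Rabs_triang|].
        change (Rabs (v - u) < d - Rabs (u - t)) in Hv; lra. }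
      apply is_derive_unique in H; apply is_derive_unique in H0; congruence. }
    assert (Hxy : forall u, Rabs (u - t) < d -> x u = x 0 /\ y u = y 0).
    { intros u Hu; specialize (HS0 u Hu); specialize (DS u Hu); unfold S in HS0.
      specialize (Hk0 u); unfold k in Hk0.
      split; apply Rminus_diag_uniq; apply (Rmult_eq_reg_l (x1 u * y2 u - y1 u * x2 u));
        try assumption; rewrite Rmult_0_r.
      - replace (_ * _) with (x1 u * ((x u - x 0) * y2 u - (y u - y 0) * x2 u)
          - x2 u * ((x u - x 0) * y1 u - (y u - y 0) * x1 u)) by ring.
        rewrite HS0, DS; ring.
      - replace (_ * _) with (y1 u * ((x u - x 0) * y2 u - (y u - y 0) * x2 u)
          - y2 u * ((x u - x 0) * y1 u - (y u - y 0) * x1 u)) by ring.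
        rewrite HS0, DS; ring. }
    (* The curve would stand still at (x 0, y 0) near t, against simplicity. *)
    set (u := t + Rmin (d / 2) (L / 2)).
    assert (t < u /\ u < t + d /\ u < t + L)
      by (unfold u, Rmin; destruct (Rle_dec _ _); lra).
    destruct (Hxy u) as [E1 E2]; [rewrite Rabs_pos_eq; lra|].
    destruct (Hxy t) as [E3 E4]; [rewrite Rminus_diag, Rabs_R0; lra|].
    apply (loop_simple _ _ _ _ _ _ _ HC t u); [lra | congruence..]. }
  split; [exact HW0|].
  assert (Hl0 : forall t, lam t = 0).
  { intros t; unfold lam; rewrite HW0; unfold Rdiv; ring. }
  assert (Ea : forall t, a t = a 0).
  { apply (constant_of_zero_derive a _ Da); intros t; rewrite Hl0; ring. }
  assert (Eb : forall t, b t = b 0).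
  { apply (constant_of_zero_derive b _ Db); intros t; rewrite Hl0; ring. }
  assert (Ec : forall t, c t = c 0).
  { apply (constant_of_zero_derive c _ Dc); intros t; rewrite Hl0; ring. }
  exists (a 0), (b 0), (c 0 - a 0 * x 0 - b 0 * y 0); intros t.
  rewrite <- (Ec t); unfold c at 1; rewrite (Ea t), (Eb t); ring.
Qed.

(** * The theorem for smooth graphs *)

Lemma simple_closed_no_crossing (c : R -> R * R) (L : R) :
  0 < L -> (forall t, c (t + L) = c t) ->
  (forall s t, 0 <= s < L -> 0 <= t < L -> c s = c t -> s = t) ->
  forall s t, s < t < s + L -> c s = c t -> False.
Proof.
  intros HL Hp Hinj s t Hst E.
  destruct (shift_to_period L 0 s HL) as [n Hn].
  rewrite <- (periodic_Z c L Hp n s), <- (periodic_Z c L Hp n t) in E.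
  set (s' := s + IZR n * L) in *; set (t' := t + IZR n * L) in *.
  assert (s' < t' < s' + L) by (unfold s', t'; lra).
  destruct (Rlt_le_dec t' L) as [H1|H1].
  - specialize (Hinj s' t' ltac:(lra) ltac:(lra) E); lra.
  - assert (E' : c s' = c (t' - L)).
    { rewrite E, <- (Hp (t' - L)); f_equal; ring. }
    specialize (Hinj s' (t' - L) ltac:(lra) ltac:(lra) E'); lra.
Qed.

Lemma smooth_derive_n (f : R -> R) (n : nat) :
  smooth f -> forall t, is_derive (Derive_n f n) t (Derive_n f (S n) t).
Proof. intros Hf t; apply Derive_correct, (Hf (S n) t). Qed.

Lemma smooth_continuity (f : R -> R) (n : nat) : smooth f -> continuity (Derive_n f n).
Proof.
  intros Hf; apply (continuity_of_derive _ (Derive_n f (S n))).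
  now apply smooth_derive_n.
Qed.

Lemma pos_of_div_pos (a b : R) : 0 <= b -> 0 < a / b -> 0 < a.
Proof.
  intros [Hb| <-] H.
  - apply (Rmult_lt_compat_r b) in H; [|exact Hb].
    rewrite Rmult_0_l in H; replace (a / b * b) with a in H by (field; lra); exact H.
  - unfold Rdiv in H; rewrite Rinv_0 in H; lra.
Qed.

Lemma smooth_loop (x y : R -> R) (L : R) :
  smooth x -> smooth y -> 0 < L ->
  (forall t, x (t + L) = x t) -> (forall t, y (t + L) = y t) ->
  (forall s t, s < t < s + L -> x s = x t -> y s = y t -> False) ->
  (forall t, 0 < Derive_n x 1 t * Derive_n y 2 t - Derive_n y 1 t * Derive_n x 2 t) ->
  locally_convex_loop x y (Derive_n x 1) (Derive_n y 1) (Derive_n x 2) (Derive_n y 2) L.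
Proof.
  intros Hx Hy HL Px Py Hs Hk; split; try assumption.
  - exact (smooth_derive_n x 0 Hx).
  - exact (smooth_derive_n y 0 Hy).
  - exact (smooth_derive_n x 1 Hx).
  - exact (smooth_derive_n y 1 Hy).
Qed.

(** Reversing a curve changes the sign of its first derivative and keeps that of
    the second. *)
Lemma curvature_det_sign (c : R -> R * R) :
  smooth_curve2 c -> positive_curvature c ->
  (forall t, 0 < det2 (D2 1 c t) (D2 2 c t)) \/
  (forall t, det2 (D2 1 c t) (D2 2 c t) < 0).
Proof.
  intros [Hx Hy] [H|H]; [left | right]; intros t.
  - apply (pos_of_div_pos _ (norm2 (D2 1 c t) ^ 3)); [|apply H].
    apply pow_le, sqrt_pos.
  - specialize (H (- t)); apply pos_of_div_pos in H; [|apply pow_le, sqrt_pos].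
    unfold det2, D2, reverse in H |- *; cbn [fst snd] in *.
    rewrite (Derive_n_comp_opp (fun s => fst (c s)) 1),
      (Derive_n_comp_opp (fun s => snd (c s)) 1),
      (Derive_n_comp_opp (fun s => fst (c s)) 2),
      (Derive_n_comp_opp (fun s => snd (c s)) 2), Ropp_involutive in H;
      [lra | apply filter_forall; intros u k _; auto..].
Qed.

(** The reflection h |-> - h changes the sign of the torsion. *)
Lemma planar_of_signed_torsion_det (x y h : R -> R) (L : R) :
  smooth x -> smooth y -> smooth h -> (forall t, h (t + L) = h t) ->
  locally_convex_loop x y (Derive_n x 1) (Derive_n y 1) (Derive_n x 2) (Derive_n y 2) L ->
  let W t := torsion_det (Derive_n x 1 t) (Derive_n y 1 t) (Derive_n h 1 t)
               (Derive_n x 2 t) (Derive_n y 2 t) (Derive_n h 2 t)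
               (Derive_n x 3 t) (Derive_n y 3 t) (Derive_n h 3 t) in
  (forall t, 0 <= W t) \/ (forall t, W t <= 0) ->
  (forall t, W t = 0) /\ exists a b c, forall t, h t = a * x t + b * y t + c.
Proof.
  intros Hx Hy Hh Ph HC W [HW|HW].
  - apply (planar_of_nonneg_torsion_det x y (Derive_n x 1) (Derive_n y 1)
      (Derive_n x 2) (Derive_n y 2) (Derive_n x 3) (Derive_n y 3)
      h (Derive_n h 1) (Derive_n h 2) (Derive_n h 3) L); try assumption;
      try (now apply smooth_continuity).
    + exact (smooth_derive_n x 2 Hx).
    + exact (smooth_derive_n y 2 Hy).
    + exact (smooth_derive_n h 0 Hh).
    + exact (smooth_derive_n h 1 Hh).
    + exact (smooth_derive_n h 2 Hh).
  - destruct (planar_of_nonneg_torsion_det x y (Derive_n x 1) (Derive_n y 1)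
      (Derive_n x 2) (Derive_n y 2) (Derive_n x 3) (Derive_n y 3)
      (fun t => - h t) (fun t => - Derive_n h 1 t) (fun t => - Derive_n h 2 t)
      (fun t => - Derive_n h 3 t) L) as [H0 [a [b [c Hp]]]]; try assumption;
      try (now apply smooth_continuity).
    + exact (smooth_derive_n x 2 Hx).
    + exact (smooth_derive_n y 2 Hy).
    + intros t; apply @is_derive_opp; exact (smooth_derive_n h 0 Hh t).
    + intros t; apply @is_derive_opp; exact (smooth_derive_n h 1 Hh t).
    + intros t; apply @is_derive_opp; exact (smooth_derive_n h 2 Hh t).
    + apply continuity_opp; now apply smooth_continuity.
    + intros t; now rewrite Ph.
    + intros t; specialize (HW t); unfold W, torsion_det in *; lra.
    + split.
      * intros t; specialize (H0 t); unfold W, torsion_det in *; lra.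
      * exists (- a), (- b), (- c); intros t; specialize (Hp t); lra.
Qed.

Theorem theorem1 (gamma0 : R -> R * R) (gamma : R -> R * R * R)
  (gamma0_smooth : smooth_curve2 gamma0)
  (gamma0_regular : regular2 gamma0)
  (gamma0_simple : simple_closed gamma0)
  (gamma0_curvature : positive_curvature gamma0)
  (gamma_smooth : smooth_curve3 gamma)
  (gamma_graph : graph_over gamma gamma0)
  (gamma_torsion : (forall t : R, 0 <= torsion gamma t) \/
                   (forall t : R, torsion gamma t <= 0)) :
  (forall t : R, torsion gamma t = 0) /\ lies_in_plane gamma.
Proof.
  destruct gamma_graph as [height [Hh Egamma]].
  apply functional_extensionality in Egamma; subst gamma.
  destruct gamma0_smooth as [Hx Hy].
  destruct gamma0_simple as [L [HL [Hp Hinj]]].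
  pose proof (simple_closed_no_crossing gamma0 L HL Hp Hinj) as Hs.
  set (x := fun t => fst (gamma0 t)) in *.
  set (y := fun t => snd (gamma0 t)) in *.
  set (h := fun t => height (gamma0 t)) in *.
  assert (Px : forall t, x (t + L) = x t) by (intros t; unfold x; now rewrite Hp).
  assert (Py : forall t, y (t + L) = y t) by (intros t; unfold y; now rewrite Hp).
  assert (Ph : forall t, h (t + L) = h t) by (intros t; unfold h; now rewrite Hp).
  assert (Hs' : forall s t, s < t < s + L -> x s = x t -> y s = y t -> False).
  { intros s t Hst Ex Ey; apply (Hs s t Hst), injective_projections; assumption. }
  set (W := fun t => torsion_det (Derive_n x 1 t) (Derive_n y 1 t) (Derive_n h 1 t)
               (Derive_n x 2 t) (Derive_n y 2 t) (Derive_n h 2 t)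
               (Derive_n x 3 t) (Derive_n y 3 t) (Derive_n h 3 t)).
  set (gamma := fun t => (gamma0 t, height (gamma0 t))) in *.
  set (k := fun t => Derive_n x 1 t * Derive_n y 2 t - Derive_n y 1 t * Derive_n x 2 t).
  assert (Hk : (forall t, 0 < k t) \/ (forall t, k t < 0))
    by exact (curvature_det_sign gamma0 (conj Hx Hy) gamma0_curvature).
  set (nn := fun t => norm3 (cross (D3 1 gamma t) (D3 2 gamma t)) ^ 2).
  assert (Hnn : forall t, 0 < nn t).
  { intros t; unfold nn, norm3; rewrite pow2_sqrt.
    - unfold dot3.
      change (pz (cross (D3 1 gamma t) (D3 2 gamma t))) with (k t).
      assert (0 < k t * k t) by (destruct Hk as [H|H]; specialize (H t); nra).
      set (u := px _); set (v := py _).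
      pose proof (Rle_0_sqr u); pose proof (Rle_0_sqr v); unfold Rsqr in *; lra.
    - unfold dot3; set (u := px _); set (v := py _); set (w := pz _).
      pose proof (Rle_0_sqr u); pose proof (Rle_0_sqr v); pose proof (Rle_0_sqr w).
      unfold Rsqr in *; lra. }
  assert (Etau : forall t, torsion gamma t * nn t = W t).
  { intros t; change (W t / nn t * nn t = W t); field.
    apply Rgt_not_eq, Hnn. }
  assert (HW : (forall t, 0 <= W t) \/ (forall t, W t <= 0)).
  { destruct gamma_torsion as [H|H]; [left|right]; intros t; rewrite <- Etau;
      specialize (H t); specialize (Hnn t); nra. }
  assert (Hmain : (forall t, W t = 0) /\
                  exists a b c, forall t, h t = a * x t + b * y t + c).
  { destruct Hk as [Hk|Hk].
    - apply (planar_of_signed_torsion_det x y h L); try assumption.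
      now apply smooth_loop.
    (* Exchanging x and y makes the curvature positive; it also changes the sign
       of the torsion. *)
    - destruct (planar_of_signed_torsion_det y x h L) as [H0 [a [b [c Hp']]]];
        try assumption.
      + apply smooth_loop; try assumption.
        * intros s t Hst Ey Ex; now apply (Hs' s t).
        * intros t; specialize (Hk t); unfold k in Hk; lra.
      + destruct HW as [HW|HW]; [right|left]; intros t; specialize (HW t);
          unfold W, torsion_det in *; lra.
      + split.
        * intros t; specialize (H0 t); unfold W, torsion_det in *; lra.
        * exists b, a, c; intros t; rewrite Hp'; ring. }
  destruct Hmain as [HW0 [a [b [c Hplane]]]]; split.
  - intros t; apply (Rmult_eq_reg_r (nn t)); [|apply Rgt_not_eq, Hnn].
    rewrite Etau, HW0; ring.
  - exists (- a, - b, 1), c; split.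
    + intros E; injection E; lra.
    + intros t; change (- a * x t + - b * y t + 1 * h t = c).
      rewrite Hplane; ring.
Qed.
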